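(* Let $\mathbf A\in\mathbb R^{n\times n}$ be a nonzero singular skew-symmetric matrix and let $\mathbf b\in\mathrm{range}(\mathbf A)$ be nonzero. Let $\mathbf x_j^{\rm G}$ and $\mathbf x_j^{\rm CRAIG}$ be the $j$th iterates of S$^2$CG and CRAIG for $\mathbf A\mathbf x=\mathbf b$, respectively, and let $\ell=\max_k\dim\mathcal K_k(\mathbf A,\mathbf b)$ (which is even). For each integer $j$ with $1\leq j\leq \ell/2$, we have $\mathbf x_{2j}^{\rm G}=\mathbf x_j^{\rm CRAIG}$. Moreover, S$^2$CG returns the pseudoinverse solution $\mathbf A^\dagger\mathbf b$, i.e. $\mathbf x_\ell^{\rm G}=\mathbf A^\dagger\mathbf b$.
   Context: Exact arithmetic and zero initial approximation are assumed. $\mathbf A^\dagger$ is the Moore--Penrose pseudoinverse. $\mathcal K_k(\mathbf A,\mathbf b)=\mathrm{span}\{\mathbf b,\mathbf A\mathbf b,\dots,\mathbf A^{k-1}\mathbf b\}$. The notation $\gamma\mathbf w:=\mathbf c$ means $\gamma=\|\mathbf c\|_2$; if $\gamma=0$ then stop, else $\mathbf w=\mathbf c/\gamma$. S$^2$CG: the Galerkin iterate $\mathbf x_k^{\rm G}$ is defined by $\mathbf x_k^{\rm G}\in\mathcal K_k(\mathbf A,\mathbf b)$ and $\mathbf b-\mathbf A\mathbf x_k^{\rm G}\perp\mathcal K_k(\mathbf A,\mathbf b)$. S$^2$CG computes only the iterates with even index $k=2j$, $2\le 2j\le\ell$; these exist and are unique, because in an orthonormal (Lanczos) basis of $\mathcal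 K_{2j}(\mathbf A,\mathbf b)$ the compression of $\mathbf A$ is a nonsingular $2j\times 2j$ matrix. When $\mathbf b\in\mathrm{range}(\mathbf A)$, $\ell$ is even, and S$^2$CG terminates at step $\ell$, returning $\mathbf x_\ell^{\rm G}$. CRAIG (based on Golub--Kahan bidiagonalization of $\mathbf A$ with starting vector $\mathbf b$): compute $\beta_1\mathbf u_1:=\mathbf b$, $\alpha_1\mathbf v_1:=\mathbf A^\top\mathbf u_1$, and for $j=1,2,\dots$: $\beta_{j+1}\mathbf u_{j+1}:=\mathbf A\mathbf v_j-\alpha_j\mathbf u_j$, $\alpha_{j+1}\mathbf v_{j+1}:=\mathbf A^\top\mathbf u_{j+1}-\beta_{j+1}\mathbf v_j$. Let $\mathbf V_j=[\mathbf v_1\ \cdots\ \mathbf v_j]$ and let $\mathbf B_j\in\mathbb R^{j\times j}$ be the lower bidiagonal matrix with diagonal $\alpha_1,\dots,\alpha_j$ and subdiagonal $\beta_2,\dots,\beta_j$. The CRAIG iterate is $\mathbf x_j^{\rm CRAIG}=\mathbf V_j\mathbf t_j$, where $\mathbf B_j\mathbf t_j=\beta_1\mathbf e_1$. *)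

(* Defs.v *)
From mathcomp Require Import all_boot all_order all_algebra.

Set Implicit Arguments.
Unset Strict Implicit.
Unset Printing Implicit Defensive.

Import Order.TTheory GRing.Theory Num.Theory.
Local Open Scope ring_scope.

Definition dotv (R : rcfType) (n : nat) (x y : 'cV[R]_n) : R :=
  (x^T *m y) 0 0.

Definition norm2 (R : rcfType) (n : nat) (x : 'cV[R]_n) : R :=
  Num.sqrt (dotv x x).

Definition krylov (R : rcfType) (n : nat) (A : 'M[R]_n) (b : 'cV[R]_n)
    (k : nat) : {vspace 'cV[R]_n} :=
  <<[seq A ^+ i *m b | i <- iota 0 k]>>%VS.

Definition max_dim_krylov (R : rcfType) (n : nat) (A : 'M[R]_n)
    (b : 'cV[R]_n) (l : nat) : Prop :=
  (exists k, \dim (krylov A b k) = l) /\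
  (forall k, (\dim (krylov A b k) <= l)%N).

Definition galerkin_iterate (R : rcfType) (n : nat) (A : 'M[R]_n)
    (b : 'cV[R]_n) (k : nat) (x : 'cV[R]_n) : Prop :=
  x \in krylov A b k /\
  (forall y, y \in krylov A b k -> dotv y (b - A *m x) = 0).

(* The assignment [gamma w := c]; [None] means that the algorithm stops. *)
Definition normalize (R : rcfType) (n : nat) (c : 'cV[R]_n) :
    option (R * 'cV[R]_n) :=
  let gamma := norm2 c in
  if gamma == 0 then None else Some (gamma, gamma^-1 *: c).

Record gk_data (R : rcfType) (n : nat) := GKData {
  gk_beta : R;
  gk_u : 'cV[R]_n;
  gk_alpha : R;
  gk_v : 'cV[R]_n }.

Definition gk_start (R : rcfType) (n : nat) (A : 'M[R]_n) (b : 'cV[R]_n) :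
    option (gk_data R n) :=
  if normalize b is Some (beta, u) then
    if normalize (A^T *m u) is Some (alpha, v) then
      Some (GKData beta u alpha v)
    else None
  else None.

Definition gk_step (R : rcfType) (n : nat) (A : 'M[R]_n) (s : gk_data R n) :
    option (gk_data R n) :=
  if normalize (A *m gk_v s - gk_alpha s *: gk_u s) is Some (beta, u) then
    if normalize (A^T *m u - beta *: gk_v s) is Some (alpha, v) then
      Some (GKData beta u alpha v)
    else None
  else None.

(* Indices are shifted by one: [golub_kahan A b i] is the quadruple
   (beta_{i+1}, u_{i+1}, alpha_{i+1}, v_{i+1}), or [None] if the
   bidiagonalization stops before all four are available. *)
Fixpoint golub_kahan (R : rcfType) (n : nat) (A : 'M[R]_n) (b : 'cV[R]_n)
    (i : nat) : option (gk_data R n) :=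
  if i is i'.+1 then obind (gk_step A) (golub_kahan A b i')
  else gk_start A b.

Definition gk_V (R : rcfType) (n j : nat) (s : 'I_j -> gk_data R n) :
    'M[R]_(n, j) :=
  \matrix_(i < n, k < j) gk_v (s k) i 0.

Definition gk_B (R : rcfType) (n j : nat) (s : 'I_j -> gk_data R n) :
    'M[R]_j :=
  \matrix_(i < j, k < j)
    if i == k then gk_alpha (s i)
    else if i == k.+1 :> nat then gk_beta (s i)
    else 0.

(* The right-hand side beta_1 e_1, written so as to make sense for every j. *)
Definition gk_rhs (R : rcfType) (n j : nat) (s : 'I_j -> gk_data R n) :
    'cV[R]_j :=
  \col_(i < j) if i == 0%N :> nat then gk_beta (s i) else 0.

Definition craig_iterate (R : rcfType) (n : nat) (A : 'M[R]_n)
    (b : 'cV[R]_n) (j : nat) (x : 'cV[R]_n) : Prop :=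
  exists (s : 'I_j -> gk_data R n) (t : 'cV[R]_j),
    [/\ forall i : 'I_j, golub_kahan A b i = Some (s i),
        gk_B s *m t = gk_rhs s
      & x = gk_V s *m t].

Definition penrose (R : rcfType) (m n : nat) (A : 'M[R]_(m, n)) :
    pred 'M[R]_(n, m) :=
  fun X => [&& A *m X *m A == A, X *m A *m X == X,
               (A *m X)^T == A *m X & (X *m A)^T == X *m A].

Lemma row_free_gram_unit (R : rcfType) (m n : nat) (A : 'M[R]_(m, n)) :
  row_free A -> A *m A^T \in unitmx.
Proof.
move=> fA; rewrite -row_free_unit -kermx_eq0; apply/eqP/row_matrixP => i.
rewrite row0; set w := row i _.
have w0 : w *m (A *m A^T) = 0 by apply/sub_kermxP; apply: row_sub.
have z0 : (w *m A) *m (w *m A)^T = 0.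
  by rewrite trmx_mul -!mulmxA (mulmxA A) mulmxA w0 mul0mx.
suff wA0 : w *m A = 0 by apply: (row_free_inj fA); rewrite wA0 mul0mx.
apply/matrixP=> k j; rewrite ord1 !mxE.
move/matrixP/(_ 0 0): z0; rewrite !mxE => /eqP.
rewrite psumr_eq0 => [/allP/(_ j)|l _]; last by rewrite !mxE -expr2 sqr_ge0.
by rewrite mem_index_enum => /(_ isT) /=; rewrite !mxE mulf_eq0 orbb => /eqP.
Qed.

Lemma penrose_exists (R : rcfType) (m n : nat) (A : 'M[R]_(m, n)) :
  exists X, penrose A X.
Proof.
have [r [C [F [CF uC uF]]]] : exists r (C : 'M[R]_(m, r)) (F : 'M[R]_(r, n)),
    [/\ C *m F = A, C^T *m C \in unitmx & F *m F^T \in unitmx].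
  exists (\rank A), (col_base A), (row_base A); split.
  - exact: mulmx_base.
  - rewrite -{2}[col_base A]trmxK; apply: row_free_gram_unit.
    by rewrite /row_free mxrank_tr; apply: col_base_full.
  - exact/row_free_gram_unit/row_base_free.
pose G := invmx (C^T *m C) *m C^T; pose H := F^T *m invmx (F *m F^T).
have GC : G *m C = 1%:M by rewrite -mulmxA mulVmx.
have FH : F *m H = 1%:M by rewrite mulmxA mulmxV.
have AX : A *m (H *m G) = C *m G.
  by rewrite -CF -mulmxA (mulmxA F) FH mul1mx.
have XA : H *m G *m A = H *m F.
  by rewrite -CF -mulmxA (mulmxA G) GC mul1mx.
exists (H *m G); rewrite /penrose AX XA; apply/and4P; split; apply/eqP.
- by rewrite -CF -mulmxA (mulmxA G) GC mul1mx.
- by rewrite -mulmxA (mulmxA F) FH mul1mx.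
- by rewrite /G !trmx_mul trmxK trmx_inv trmx_mul trmxK mulmxA.
- by rewrite /H !trmx_mul trmxK trmx_inv trmx_mul trmxK mulmxA.
Qed.

(* The Moore-Penrose pseudoinverse, i.e. the (unique) solution of the four
   Penrose equations; [pinvmx] of mxalgebra is a different generalized
   inverse. *)
Definition mpinv (R : rcfType) (m n : nat) (A : 'M[R]_(m, n)) :
    'M[R]_(n, m) :=
  xchoose (penrose_exists A).

(* Main.v *)
Require Import Defs.
From mathcomp Require Import all_boot all_order all_algebra.
From mathcomp Require Import reals.

Import Order.TTheory GRing.Theory Num.Theory.
Local Open Scope ring_scope.

Set Implicit Arguments.
Unset Strict Implicit.
Unset Printing Implicit Defensive.

(** Odd powers of a skew-symmetric [A] are skew-symmetric. Hence the Krylov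
    space [K_2j] of [(A, b)] is the orthogonal sum of its even part [E_j],
    spanned by [b, A^2 b, ..., A^(2j-2) b], and its odd part [O_j = A E_j]
    ([krylov_even_odd], [even_odd_orth]). The kernel and the range of [A] are
    orthogonal, so [A] is injective on its range, which contains [b] and thus
    [E_j]. Consequently [dim K_2j = 2 dim E_j] ([dim_krylov_even]), so [ell] is
    even, and a Galerkin iterate of even index is unique
    ([galerkin_unique]).

    The Golub-Kahan left vectors lie in the even parts and the right vectors in
    the odd parts. If the process stopped after [j] steps, then the span of
    [v_1, ..., v_j] would contain [A b] and be stable under [A^2], which bounds
    the dimensions of all the odd parts by [j]; so [ell / 2] steps can be made
    ([gk_runs_dim]). For [j <= ell / 2] the CRAIG iterate [x_j] exists, is
    unique, lies in [O_j], and its residual is a multiple of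
    [w = A v_j - alpha_j u_j] ([craigP]). The vector [w] is orthogonal to [O_j]
    by parity, and to [E_j = span(u_1, ..., u_j)] by orthogonality of the left
    vectors ([gk_ures_orth_krylov]). So [x_j] satisfies the Galerkin condition
    in [K_2j], and uniqueness identifies the two iterates.

    For [j = ell / 2] the orthonormal vectors [u_1, ..., u_j] exhaust the even
    parts, which contain [w]; since [w] is also orthogonal to them, [w = 0]
    ([gk_ures_last]) and [A x_j = b]. As [x_j] is in the range of [A], it is the
    pseudoinverse solution ([mpinv_skew]). *)

(** * The Euclidean inner product *)

Lemma dotvC (R : rcfType) n (x y : 'cV[R]_n) : dotv x y = dotv y x.
Proof. by rewrite /dotv -[in RHS](trmxK x) -trmx_mul [RHS]mxE. Qed.

Lemma dotvDr (R : rcfType) n (x y z : 'cV[R]_n) :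
  dotv x (y + z) = dotv x y + dotv x z.
Proof. by rewrite /dotv mulmxDr mxE. Qed.

Lemma dotvZr (R : rcfType) n a (x y : 'cV[R]_n) :
  dotv x (a *: y) = a * dotv x y.
Proof. by rewrite /dotv -scalemxAr mxE. Qed.

Lemma dotv0r (R : rcfType) n (x : 'cV[R]_n) : dotv x 0 = 0.
Proof. by rewrite /dotv mulmx0 mxE. Qed.

Lemma dotvNr (R : rcfType) n (x y : 'cV[R]_n) : dotv x (- y) = - dotv x y.
Proof. by rewrite -scaleN1r dotvZr mulN1r. Qed.

Lemma dotvBr (R : rcfType) n (x y z : 'cV[R]_n) :
  dotv x (y - z) = dotv x y - dotv x z.
Proof. by rewrite dotvDr dotvNr. Qed.

Lemma dotv_sumr (R : rcfType) n (I : finType) (x : 'cV[R]_n) (F : I -> 'cV_n) :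
  dotv x (\sum_i F i) = \sum_i dotv x (F i).
Proof. by rewrite /dotv mulmx_sumr summxE. Qed.

Lemma dotv_mulr (R : rcfType) n (A : 'M[R]_n) (x y : 'cV[R]_n) :
  dotv x (A *m y) = dotv (A^T *m x) y.
Proof. by rewrite /dotv trmx_mul trmxK mulmxA. Qed.

Lemma dotv_ge0 (R : rcfType) n (x : 'cV[R]_n) : 0 <= dotv x x.
Proof.
by rewrite /dotv mxE; apply: sumr_ge0 => i _; rewrite mxE -expr2 sqr_ge0.
Qed.

Lemma dotv_eq0 (R : rcfType) n (x : 'cV[R]_n) : (dotv x x == 0) = (x == 0).
Proof.
apply/eqP/eqP => [|->]; last exact: dotv0r.
rewrite /dotv mxE => /eqP; rewrite psumr_eq0 => [/allP h|i _]; last first.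
  by rewrite mxE -expr2 sqr_ge0.
apply/matrixP => i j; rewrite ord1 mxE.
by have := h i (mem_index_enum i); rewrite /= mxE mulf_eq0 orbb => /eqP.
Qed.

(** The hyperplane (or whole space) of the vectors orthogonal to [x]. *)
Definition orthv (R : rcfType) n (x : 'cV[R]_n) : {vspace 'cV[R]_n} :=
  lker (linfun (mulmx x^T : 'cV[R]_n -> 'M[R]_1)).

Lemma mem_orthv (R : rcfType) n (x y : 'cV[R]_n) :
  (y \in orthv x) = (dotv x y == 0).
Proof.
rewrite memv_ker lfunE /=; apply/eqP/eqP => [h|h]; first by rewrite /dotv h mxE.
by apply/matrixP => i j; rewrite !ord1 [RHS]mxE.
Qed.

Lemma orthonormal_free (R : rcfType) n m (u : nat -> 'cV[R]_n) :
  (forall i k, (i < m)%N -> (k < m)%N -> dotv (u i) (u k) = (i == k)%:R) ->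
  free (mkseq u m).
Proof.
move=> hu; have sz : size (mkseq u m) == m by rewrite size_mkseq.
apply/(@freeP _ _ m (Tuple sz)) => c hc i.
have := congr1 (dotv (u i)) hc; rewrite dotv0r dotv_sumr (bigD1 i) //= big1.
  by rewrite addr0 nth_mkseq // dotvZr hu // eqxx mulr1.
move=> k ki; rewrite nth_mkseq // dotvZr hu //.
by rewrite eq_sym (inj_eq val_inj) (negbTE ki) mulr0.
Qed.

(** * Krylov spaces of a skew-symmetric matrix *)

(** Left multiplication by [A], as an endomorphism. *)
Definition mulv (R : rcfType) n (A : 'M[R]_n) : 'End('cV[R]_n) :=
  linfun (mulmx A).

Lemma mulvE (R : rcfType) n (A : 'M[R]_n) x : mulv A x = A *m x.
Proof. by rewrite lfunE. Qed.

Lemma mem_krylov (R : rcfType) n (A : 'M[R]_n) (b : 'cV[R]_n) i k :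
  (i < k)%N -> A ^+ i *m b \in krylov A b k.
Proof.
by move=> ik; apply/memv_span/mapP; exists i; rewrite // mem_iota.
Qed.

Lemma krylov_subv (R : rcfType) n (A : 'M[R]_n) (b : 'cV[R]_n) k
    (U : {vspace 'cV[R]_n}) :
  (forall i, (i < k)%N -> A ^+ i *m b \in U) -> (krylov A b k <= U)%VS.
Proof.
by move=> h; apply/span_subvP => _ /mapP[i + ->]; rewrite mem_iota => /h.
Qed.

Lemma krylovS (R : rcfType) n (A : 'M[R]_n) (b : 'cV[R]_n) k k' :
  (k <= k')%N -> (krylov A b k <= krylov A b k')%VS.
Proof.
by move=> kk'; apply: krylov_subv => i /leq_trans/(_ kk'); apply: mem_krylov.
Qed.

Lemma mulv_krylov (R : rcfType) n (A : 'M[R]_n) (b : 'cV[R]_n) k x :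
  x \in krylov A b k -> A *m x \in krylov A b k.+1.
Proof.
suff h : (krylov A b k <= mulv A @^-1: krylov A b k.+1)%VS.
  by move/(subvP h); rewrite -memv_preim mulvE.
apply: krylov_subv => i ik; rewrite -memv_preim mulvE mulmxA mulmxE -exprS.
exact: mem_krylov.
Qed.

Lemma krylov_sub_stable (R : rcfType) n (A : 'M[R]_n) (b : 'cV[R]_n) k
    (U : {vspace 'cV[R]_n}) :
  b \in U -> (forall x, x \in U -> A *m x \in U) -> (krylov A b k <= U)%VS.
Proof.
move=> bU AU; apply: krylov_subv => i _.
elim: i => [|i IH]; first by rewrite expr0 mul1mx.
by rewrite exprS -mulmxE -mulmxA AU.
Qed.

(** The span of the even powers [b], [A^2 b], up to [A^(2j-2) b]. *)
Definition evenK (R : rcfType) n (A : 'M[R]_n) (b : 'cV[R]_n) j :=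
  krylov (A ^+ 2) b j.

(** The span of the odd powers [A b], [A^3 b], up to [A^(2j-1) b]. *)
Definition oddK (R : rcfType) n (A : 'M[R]_n) (b : 'cV[R]_n) j :=
  krylov (A ^+ 2) (A *m b) j.

Lemma mulmx_sq (R : rcfType) n (A : 'M[R]_n) (x : 'cV[R]_n) :
  A ^+ 2 *m x = A *m (A *m x).
Proof. by rewrite expr2 mulmxA. Qed.

Lemma krylov_even_odd (R : rcfType) n (A : 'M[R]_n) (b : 'cV[R]_n) j :
  krylov A b (2 * j) = (evenK A b j + oddK A b j)%VS.
Proof.
apply/eqP; rewrite eqEsubv subv_add; apply/and3P; split.
- apply: krylov_subv => i ij; rewrite -(odd_double_half i) addnC -mul2n.
  have hj : (i./2 < j)%N.
    by rewrite ltn_half_double -mul2n.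
  case: (odd i).
    rewrite exprD expr1 -mulmxE -mulmxA exprM.
    by apply: subvP (addvSr _ _) _ _; apply: mem_krylov.
  by rewrite addn0 exprM; apply: subvP (addvSl _ _) _ _; apply: mem_krylov.
- apply: krylov_subv => i ij; rewrite -exprM; apply: mem_krylov.
  by rewrite ltn_pmul2l.
- apply: krylov_subv => i ij; rewrite -exprM mulmxA mulmxE -exprSr.
  by apply: mem_krylov; rewrite !mul2n ltn_Sdouble.
Qed.

Lemma oddK_img (R : rcfType) n (A : 'M[R]_n) (b : 'cV[R]_n) j :
  oddK A b j = (mulv A @: evenK A b j)%VS.
Proof.
rewrite /oddK /evenK /krylov limg_span -map_comp; congr span.
apply: eq_map => i /=; rewrite mulvE !mulmxA !mulmxE; congr (_ *m _).
by rewrite -exprM -exprS -exprSr.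
Qed.

Lemma mulv_evenK (R : rcfType) n (A : 'M[R]_n) (b : 'cV[R]_n) j x :
  x \in evenK A b j -> A *m x \in oddK A b j.
Proof. by move=> xE; rewrite oddK_img -mulvE memv_img. Qed.

Lemma mulv_oddK (R : rcfType) n (A : 'M[R]_n) (b : 'cV[R]_n) j x :
  x \in oddK A b j -> A *m x \in evenK A b j.+1.
Proof.
rewrite oddK_img => /memv_imgP[y yE ->]; rewrite mulvE -mulmx_sq.
exact: mulv_krylov.
Qed.

Lemma evenK_sub (R : rcfType) n (A : 'M[R]_n) (b : 'cV[R]_n) j x :
  x \in evenK A b j -> x \in krylov A b (2 * j).
Proof. by rewrite krylov_even_odd; apply/subvP/addvSl. Qed.

Lemma oddK_sub (R : rcfType) n (A : 'M[R]_n) (b : 'cV[R]_n) j x :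
  x \in oddK A b j -> x \in krylov A b (2 * j).
Proof. by rewrite krylov_even_odd; apply/subvP/addvSr. Qed.

Lemma trmx_expr (R : rcfType) n (A : 'M[R]_n) k : (A ^+ k)^T = A^T ^+ k.
Proof.
by elim: k => [|k IH]; rewrite ?expr0 ?trmx1 // exprSr exprS trmx_mul IH.
Qed.

Lemma dotv_skew (R : rcfType) n (A : 'M[R]_n) (x y : 'cV[R]_n) :
  A^T = - A -> dotv x (A *m y) = - dotv (A *m x) y.
Proof. by move=> skA; rewrite dotv_mulr skA mulNmx dotvC dotvNr dotvC. Qed.

Lemma skew_odd_form (R : rcfType) n (A : 'M[R]_n) (b : 'cV[R]_n) k :
  A^T = - A -> odd k -> dotv b (A ^+ k *m b) = 0.
Proof.
move=> skA ok; apply/eqP; rewrite -eqNr eq_sym; apply/eqP.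
by rewrite {1}dotv_mulr trmx_expr skA exprNn -signr_odd ok expr1 mulN1r
  mulNmx dotvC dotvNr.
Qed.

(** An odd power of a skew-symmetric matrix is skew-symmetric, so the even and
    odd parts of a Krylov space are orthogonal. *)
Lemma even_odd_orth (R : rcfType) n (A : 'M[R]_n) (b : 'cV[R]_n) j k x y :
  A^T = - A -> x \in evenK A b j -> y \in oddK A b k -> dotv x y = 0.
Proof.
move=> skA xE yO; apply/eqP; rewrite -mem_orthv; apply: subvP yO.
apply: krylov_subv => i _; rewrite mem_orthv dotvC -mem_orthv.
apply: subvP xE; apply: krylov_subv => i' _.
rewrite mem_orthv dotvC -!exprM.
have -> : A ^+ (2 * i) *m (A *m b) = A ^+ (2 * i).+1 *m b.
  by rewrite mulmxA mulmxE -exprSr.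
rewrite dotvC dotv_mulr trmx_expr skA exprNn exprM sqrrN expr1n expr1n mul1r.
rewrite mulmxA mulmxE -exprD dotvC skew_odd_form //.
by rewrite addnS /= oddD !oddM.
Qed.

(** The range of a skew-symmetric matrix is orthogonal to its kernel. *)
Lemma skew_inj_range (R : rcfType) n (A : 'M[R]_n) x :
  A^T = - A -> x \in limg (mulv A) -> A *m x = 0 -> x = 0.
Proof.
move=> skA /memv_imgP[z _ ->]; rewrite mulvE => h; apply/eqP.
by rewrite -dotv_eq0 dotv_skew // h dotvC dotv0r oppr0.
Qed.

Lemma evenK_range (R : rcfType) n (A : 'M[R]_n) (b : 'cV[R]_n) j :
  b \in limg (mulv A) -> (evenK A b j <= limg (mulv A))%VS.
Proof.
move=> bA; apply: krylov_sub_stable => // x _.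
by rewrite mulmx_sq -(mulvE A (A *m x)) memv_img // memvf.
Qed.

Lemma dim_oddK (R : rcfType) n (A : 'M[R]_n) (b : 'cV[R]_n) j :
  A^T = - A -> b \in limg (mulv A) ->
  \dim (oddK A b j) = \dim (evenK A b j).
Proof.
move=> skA bA; rewrite oddK_img limg_dim_eq //.
apply/eqP; rewrite -subv0; apply/subvP => x /memv_capP[xE].
rewrite memv_ker mulvE => /eqP /(skew_inj_range skA) -> //.
  by rewrite mem0v.
exact: subvP (evenK_range _ bA) _ xE.
Qed.

Lemma dim_krylov_even (R : rcfType) n (A : 'M[R]_n) (b : 'cV[R]_n) j :
  A^T = - A -> b \in limg (mulv A) ->
  \dim (krylov A b (2 * j)) = (2 * \dim (evenK A b j))%N.
Proof.
move=> skA bA; rewrite krylov_even_odd dimv_disjoint_sum; last first.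
  apply/eqP; rewrite -subv0; apply/subvP => x /memv_capP[xE xO].
  by rewrite memv0 -dotv_eq0 (even_odd_orth skA xE xO).
by rewrite dim_oddK // mul2n addnn.
Qed.

(** If two Galerkin iterates differ by [d = e + A e'], with [e] and [e'] in the
    even part, then orthogonality of [A d] to [A e] and to [e'] forces
    [A e = 0] and [A e' = 0]. *)
Lemma galerkin_unique (R : rcfType) n (A : 'M[R]_n) (b : 'cV[R]_n) j x y :
  A^T = - A -> b \in limg (mulv A) ->
  galerkin_iterate A b (2 * j) x -> galerkin_iterate A b (2 * j) y -> x = y.
Proof.
move=> skA bA [xK xo] [yK yo]; apply/eqP; rewrite -subr_eq0.
(* Both residuals are orthogonal to the Krylov space, hence so is [A d]. *)
have orth z : z \in krylov A b (2 * j) -> dotv z (A *m (x - y)) = 0.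
  move=> zK; have := xo z zK; have := yo z zK.
  rewrite mulmxBr !dotvBr => /eqP; rewrite subr_eq0 => /eqP <- /eqP.
  by rewrite subr_eq0 => /eqP ->; rewrite subrr.
have : x - y \in krylov A b (2 * j) by rewrite rpredB.
rewrite {1}krylov_even_odd => /memv_addP[e eE [o oO dE]].
move: orth; rewrite dE => orth.
have e0 : e = 0.
  apply: (skew_inj_range skA); first exact: subvP (evenK_range _ bA) _ eE.
  apply/eqP; rewrite -dotv_eq0; apply/eqP.
  rewrite -(orth (A *m e)); last exact/oddK_sub/mulv_evenK.
  rewrite mulmxDr dotvDr [X in _ + X]dotvC.
  by rewrite (even_odd_orth skA (mulv_oddK oO) (mulv_evenK eE)) addr0.
move: oO orth; rewrite e0 add0r oddK_img => /memv_imgP[e' eE' ->].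
rewrite mulvE => /(_ e' (evenK_sub eE')); rewrite dotv_skew // => /eqP.
by rewrite oppr_eq0 dotv_eq0.
Qed.

(** * The pseudoinverse solution *)

(** For skew-symmetric [A], with pseudoinverse [P], transposing [A P A = A] and
    using the symmetry of [P A] gives [P A A = A]; so [P A] fixes the range of
    [A]. *)
Lemma mpinv_skew (R : rcfType) n (A : 'M[R]_n) x :
  A^T = - A -> x \in limg (mulv A) -> mpinv A *m (A *m x) = x.
Proof.
move=> skA /memv_imgP[z _ ->]; rewrite mulvE.
have /and4P[/eqP APA _ _ /eqP PA] := xchooseP (penrose_exists A).
rewrite -/(mpinv A) in APA PA.
suff -> : mpinv A *m (A *m (A *m z)) = mpinv A *m A *m A *m z.
  congr (_ *m _); apply: trmx_inj; rewrite trmx_mul PA skA mulNmx mulmxA.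
  by rewrite APA.
by rewrite !mulmxA.
Qed.

(** * Golub-Kahan bidiagonalization *)

Lemma normalize_Some (R : rcfType) n (c w : 'cV[R]_n) g :
  normalize c = Some (g, w) -> [/\ g != 0, c = g *: w & dotv w w = 1].
Proof.
rewrite /normalize; case: ifPn => // c0 [<- <-].
split=> //; first by rewrite scalerA mulfV // scale1r.
rewrite dotvZr dotvC dotvZr mulrA -expr2 exprVn /norm2 sqr_sqrtr ?dotv_ge0 //.
rewrite mulVf //; apply: contra c0 => /eqP c0.
by rewrite /norm2 c0 sqrtr0.
Qed.

Lemma normalize_None (R : rcfType) n (c : 'cV[R]_n) :
  normalize c = None -> c = 0.
Proof.
rewrite /normalize; case: ifP => // /eqP + _.
move/(congr1 (fun x => x ^+ 2)); rewrite expr0n /norm2 sqr_sqrtr ?dotv_ge0 //.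
by move/eqP; rewrite dotv_eq0 => /eqP.
Qed.

(** The data of step [i], with an irrelevant default value when the
    bidiagonalization has stopped before. *)
Definition gk (R : rcfType) n (A : 'M[R]_n) (b : 'cV[R]_n) i : gk_data R n :=
  odflt (GKData 0 0 0 0) (golub_kahan A b i).

(** The first [m] steps of the bidiagonalization do not stop. *)
Definition gk_runs (R : rcfType) n (A : 'M[R]_n) (b : 'cV[R]_n) m : Prop :=
  forall i, (i < m)%N -> golub_kahan A b i = Some (gk A b i).

(** The vector normalized into [u_i], in 0-based indexing: [b] if [i = 0], and
    [A v_(i-1) - alpha_(i-1) u_(i-1)] otherwise. *)
Definition gk_ures (R : rcfType) n (A : 'M[R]_n) (b : 'cV[R]_n) i : 'cV[R]_n :=
  if i is i'.+1
  then A *m gk_v (gk A b i') - gk_alpha (gk A b i') *: gk_u (gk A b i') else b.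

(** The vector [v_(i-1)], with [v_(-1) = 0]. *)
Definition gk_vprev (R : rcfType) n (A : 'M[R]_n) (b : 'cV[R]_n) i :
    'cV[R]_n :=
  if i is i'.+1 then gk_v (gk A b i') else 0.

(** Uniform description of the initial step and of the subsequent ones. *)
Lemma golub_kahanE (R : rcfType) n (A : 'M[R]_n) (b : 'cV[R]_n) i :
  gk_runs A b i ->
  golub_kahan A b i =
    if normalize (gk_ures A b i) is Some (beta, u) then
      if normalize (A^T *m u - beta *: gk_vprev A b i) is Some (alpha, v)
      then Some (GKData beta u alpha v) else None
    else None.
Proof.
case: i => [|i] h.
  by rewrite /= /gk_start; case: normalize => // -[g u]; rewrite scaler0 subr0.
by rewrite [LHS]/= (h i).
Qed.

Lemma gk_runsW (R : rcfType) n (A : 'M[R]_n) (b : 'cV[R]_n) m m' :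
  (m' <= m)%N -> gk_runs A b m -> gk_runs A b m'.
Proof. by move=> mm' h i im; apply: h; apply: leq_trans mm'. Qed.

Lemma gkP (R : rcfType) n (A : 'M[R]_n) (b : 'cV[R]_n) m i (s := gk A b i) :
  gk_runs A b m -> (i < m)%N ->
  [/\ gk_ures A b i = gk_beta s *: gk_u s,
      A^T *m gk_u s = gk_alpha s *: gk_v s + gk_beta s *: gk_vprev A b i,
      dotv (gk_u s) (gk_u s) = 1 /\ dotv (gk_v s) (gk_v s) = 1
    & gk_beta s != 0 /\ gk_alpha s != 0].
Proof.
move=> h im; have := h i im; rewrite golub_kahanE; last first.
  exact: gk_runsW (ltnW im) h.
rewrite -/s; case En: normalize => [[be u]|//].
case En': normalize => [[al v]|//] [<-] /=.
have [be0 ru uu] := normalize_Some En; have [al0 rv vv] := normalize_Some En'.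
by split=> //; rewrite -rv subrK.
Qed.

(** The recurrence for [A v_i], read as a definition of the next residual. *)
Lemma gk_mulv (R : rcfType) n (A : 'M[R]_n) (b : 'cV[R]_n) i :
  A *m gk_v (gk A b i) =
    gk_alpha (gk A b i) *: gk_u (gk A b i) + gk_ures A b i.+1.
Proof. by rewrite addrC subrK. Qed.

Lemma gk_mulvS (R : rcfType) n (A : 'M[R]_n) (b : 'cV[R]_n) m i :
  gk_runs A b m -> (i.+1 < m)%N ->
  A *m gk_v (gk A b i) =
    gk_alpha (gk A b i) *: gk_u (gk A b i)
    + gk_beta (gk A b i.+1) *: gk_u (gk A b i.+1).
Proof. by move=> h im; rewrite gk_mulv; have [->] := gkP h im. Qed.

(** The last vector [A v_k - alpha_k u_k] formed is orthogonal to all the [u_i]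
    because [A^T u_i] is a combination of [v_i] and [v_(i-1)]. *)
Lemma gk_ures_orth (R : rcfType) n (A : 'M[R]_n) (b : 'cV[R]_n) k :
  gk_runs A b k ->
  (forall i j, (i < j)%N -> (j < k)%N ->
     dotv (gk_u (gk A b i)) (gk_u (gk A b j)) = 0 /\
     dotv (gk_v (gk A b i)) (gk_v (gk A b j)) = 0) ->
  forall i, (i < k)%N -> dotv (gk_u (gk A b i)) (gk_ures A b k) = 0.
Proof.
case: k => // k h IH i ik; rewrite /= dotvBr dotv_mulr dotvZr.
have [_ -> [uu vv] _] := gkP h ik.
rewrite dotvC dotvDr !dotvZr.
have -> : dotv (gk_v (gk A b k)) (gk_vprev A b i) = 0.
  case: i ik {uu vv} => [|i] ik; first exact: dotv0r.
  by rewrite dotvC; have [] := IH i k ik (ltnSn k).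
rewrite mulr0 addr0; have [ik'|ki] := ltnP i k.
  have [-> ] := IH i k ik' (ltnSn k); rewrite dotvC => ->.
  by rewrite !mulr0 subrr.
have -> : k = i by apply/eqP; rewrite eqn_leq ki -ltnS ik.
by rewrite uu vv subrr.
Qed.

(** The induction step moves from the [u_j] to the [v_j] by the same argument,
    [A v_i] being a combination of [u_i] and [u_(i+1)]. *)
Lemma gk_orth (R : rcfType) n (A : 'M[R]_n) (b : 'cV[R]_n) m :
  gk_runs A b m ->
  forall i j, (i < j)%N -> (j < m)%N ->
     dotv (gk_u (gk A b i)) (gk_u (gk A b j)) = 0 /\
     dotv (gk_v (gk A b i)) (gk_v (gk A b j)) = 0.
Proof.
elim: m => // m IHm h i j ij; rewrite ltnS leq_eqVlt.
case/orP => [/eqP jm|]; last by apply: IHm => //; apply: gk_runsW h.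
have {}IHm := IHm (gk_runsW (leqnSn m) h).
subst j; have im := leq_trans ij (leqnSn m).
have ru := gk_ures_orth (gk_runsW (leqnSn m) h) IHm.
have [uE Au _ [be0 al0]] := gkP h (ltnSn m).
have u0 k : (k < m)%N -> dotv (gk_u (gk A b k)) (gk_u (gk A b m)) = 0.
  move=> km; have := ru k km; rewrite uE dotvZr => /eqP.
  by rewrite mulf_eq0 (negbTE be0) => /eqP.
split; first exact: u0.
have := congr1 (dotv (gk_v (gk A b i))) Au.
rewrite dotv_mulr trmxK (gk_mulvS h (i := i) ij) dotvC !dotvDr !dotvZr.
rewrite [X in _ * X + _]dotvC u0 // mulr0 add0r.
have [im1|im1] := ltnP i.+1 m.
  rewrite [X in _ * X = _]dotvC u0 // mulr0.
  have -> : dotv (gk_v (gk A b i)) (gk_vprev A b m) = 0.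
    move: im1 IHm; case: (m) => // j im1 IHm.
    by have [] := IHm i j im1 (ltnSn j).
  rewrite mulr0 addr0 => /esym/eqP; rewrite mulf_eq0 (negbTE al0) => /eqP.
  exact.
have em : m = i.+1 by apply/eqP; rewrite eqn_leq ij im1.
rewrite em /= -em.
have [_ _ [_ ->] _] := gkP h im.
have [_ _ [-> _] _] := gkP h (ltnSn m).
move/eqP; rewrite -subr_eq subrr eq_sym mulf_eq0 (negbTE al0) => /eqP.
exact.
Qed.

Lemma gk_orthonormal (R : rcfType) n (A : 'M[R]_n) (b : 'cV[R]_n) m :
  gk_runs A b m ->
  forall i k, (i < m)%N -> (k < m)%N ->
    dotv (gk_u (gk A b i)) (gk_u (gk A b k)) = (i == k)%:R.
Proof.
move=> h i k im km; have [ik|ki|<-] := ltngtP i k.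
- by have [] := gk_orth h ik km.
- by rewrite dotvC; have [] := gk_orth h ki im.
- by have [_ _ [] ] := gkP h im.
Qed.

(** * The bidiagonalization of a skew-symmetric matrix *)

(** The span of the first [j] left vectors [u_0], ..., [u_(j-1)]. *)
Definition spanu (R : rcfType) n (A : 'M[R]_n) (b : 'cV[R]_n) j :=
  <<mkseq (fun i => gk_u (gk A b i)) j>>%VS.

(** The span of the first [j] right vectors [v_0], ..., [v_(j-1)]. *)
Definition spanv (R : rcfType) n (A : 'M[R]_n) (b : 'cV[R]_n) j :=
  <<mkseq (fun i => gk_v (gk A b i)) j>>%VS.

Lemma mem_spanu (R : rcfType) n (A : 'M[R]_n) (b : 'cV[R]_n) i j :
  (i < j)%N -> gk_u (gk A b i) \in spanu A b j.
Proof.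
by move=> ij; apply/memv_span/mapP; exists i; rewrite // mem_iota.
Qed.

Lemma mem_spanv (R : rcfType) n (A : 'M[R]_n) (b : 'cV[R]_n) i j :
  (i < j)%N -> gk_v (gk A b i) \in spanv A b j.
Proof.
by move=> ij; apply/memv_span/mapP; exists i; rewrite // mem_iota.
Qed.

Lemma spanu_subv (R : rcfType) n (A : 'M[R]_n) (b : 'cV[R]_n) j
    (U : {vspace 'cV[R]_n}) :
  (forall i, (i < j)%N -> gk_u (gk A b i) \in U) -> (spanu A b j <= U)%VS.
Proof.
by move=> h; apply/span_subvP => _ /mapP[i + ->]; rewrite mem_iota => /h.
Qed.

Lemma spanv_subv (R : rcfType) n (A : 'M[R]_n) (b : 'cV[R]_n) j
    (U : {vspace 'cV[R]_n}) :
  (forall i, (i < j)%N -> gk_v (gk A b i) \in U) -> (spanv A b j <= U)%VS.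
Proof.
by move=> h; apply/span_subvP => _ /mapP[i + ->]; rewrite mem_iota => /h.
Qed.

Lemma mem_vprev (R : rcfType) n (A : 'M[R]_n) (b : 'cV[R]_n) i
    (U : {vspace 'cV[R]_n}) :
  (forall i', (i' < i)%N -> gk_v (gk A b i') \in U) -> gk_vprev A b i \in U.
Proof. by case: i => [|i] h; rewrite ?mem0v ?h. Qed.

(** Skew-symmetry turns the recurrence for [A^T u_i] into one for [A u_i]. *)
Lemma mulv_spanu (R : rcfType) n (A : 'M[R]_n) (b : 'cV[R]_n) j x :
  A^T = - A -> gk_runs A b j -> x \in spanu A b j -> A *m x \in spanv A b j.
Proof.
move=> skA h; rewrite -mulvE memv_preim; apply: subvP.
apply: spanu_subv => i ij; rewrite -memv_preim mulvE.
have [_ + _ _] := gkP h ij; rewrite skA mulNmx -rpredN => ->.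
by rewrite rpredD ?rpredZ ?mem_spanv ?mem_vprev // => i' ii;
  rewrite mem_spanv // (ltn_trans ii).
Qed.

Lemma gk_ures_span (R : rcfType) n (A : 'M[R]_n) (b : 'cV[R]_n) m i :
  gk_runs A b m -> (i < m)%N -> gk_ures A b i \in spanu A b m.
Proof.
by move=> h im; have [-> _ _ _] := gkP h im; rewrite rpredZ ?mem_spanu.
Qed.

Lemma mulv_spanv (R : rcfType) n (A : 'M[R]_n) (b : 'cV[R]_n) j x :
  gk_runs A b j -> x \in spanv A b j ->
  A *m x \in (spanu A b j + <[gk_ures A b j]>)%VS.
Proof.
move=> h; rewrite -mulvE memv_preim; apply: subvP.
apply: spanv_subv => i ij; rewrite -memv_preim mulvE gk_mulv rpredD //.
  by apply: subvP (addvSl _ _) _ _; rewrite rpredZ ?mem_spanu.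
move: ij; rewrite leq_eqVlt => /orP[/eqP ->|ij].
  by apply: subvP (addvSr _ _) _ _; apply: memv_line.
by apply: subvP (addvSl _ _) _ _; apply: gk_ures_span ij.
Qed.

Lemma dim_spanv (R : rcfType) n (A : 'M[R]_n) (b : 'cV[R]_n) j :
  (\dim (spanv A b j) <= j)%N.
Proof. by apply: leq_trans (dim_span _) _; rewrite size_mkseq. Qed.

Lemma b_span (R : rcfType) n (A : 'M[R]_n) (b : 'cV[R]_n) j :
  gk_runs A b j -> b \in (spanu A b j + <[gk_ures A b j]>)%VS.
Proof.
case: j => [|j] h; first by apply: subvP (addvSr _ _) _ _; apply: memv_line.
apply: subvP (addvSl _ _) _ _.
exact: (gk_ures_span h (ltn0Sn j)).
Qed.

(** Let [w] be the vector that step [j] (0-based) has to normalize. The last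
    hypothesis, [A w] in the span of [v_0], ..., [v_(j-1)], holds whenever the
    process stops there: then either [w = 0] or [A^T w] is a multiple of
    [v_(j-1)]. It makes that span stable under [A^2]; as the span also contains
    [A b], it contains all the odd parts. *)
Lemma gk_stop_dim (R : rcfType) n (A : 'M[R]_n) (b : 'cV[R]_n) j k :
  A^T = - A -> gk_runs A b j -> A *m gk_ures A b j \in spanv A b j ->
  (\dim (oddK A b k) <= j)%N.
Proof.
move=> skA h stop.
have AW x :
    x \in (spanu A b j + <[gk_ures A b j]>)%VS -> A *m x \in spanv A b j.
  case/memv_addP=> y yU [z /vlineP[c ->] ->].
  by rewrite mulmxDr -scalemxAr rpredD ?rpredZ // mulv_spanu.
apply: leq_trans (dimvS _) (dim_spanv A b j).
apply: krylov_sub_stable => [|x xV]; first exact/AW/b_span.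
by rewrite mulmx_sq; apply/AW/mulv_spanv.
Qed.

(** The number of possible steps is at least the dimension of any odd part. *)
Lemma gk_runs_dim (R : rcfType) n (A : 'M[R]_n) (b : 'cV[R]_n) k :
  A^T = - A -> gk_runs A b (\dim (oddK A b k)).
Proof.
move=> skA; set m := \dim _.
suff h j : (j <= m)%N -> gk_runs A b j by exact: h.
elim: j => [|j IH] jm; first by [].
have {}IH := IH (ltnW jm) => i; rewrite ltnS leq_eqVlt.
case/orP => [/eqP -> {i}|]; last exact: IH.
case Eg: (golub_kahan A b j) => [s|]; first by rewrite /gk Eg.
move: Eg; rewrite golub_kahanE // => stop; exfalso.
suff : (m <= j)%N by rewrite leqNgt jm.
apply: gk_stop_dim => //.
case En: normalize stop => [[be u]|]; last first.
  by move=> _; rewrite (normalize_None En) mulmx0 mem0v.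
have [_ -> _] := normalize_Some En.
case En': normalize => [[al v]|] // _.
move/normalize_None/eqP: En'; rewrite subr_eq0 skA mulNmx => /eqP Au.
rewrite -scalemxAr rpredZ // -rpredN Au rpredZ // mem_vprev // => i ij.
exact: mem_spanv.
Qed.

Lemma gk_ures_even (R : rcfType) n (A : 'M[R]_n) (b : 'cV[R]_n) i :
  (forall i', (i' < i)%N ->
     gk_u (gk A b i') \in evenK A b i'.+1 /\
     gk_v (gk A b i') \in oddK A b i'.+1) ->
  gk_ures A b i \in evenK A b i.+1.
Proof.
case: i => [|i] h /=.
  by have := mem_krylov (A ^+ 2) b (ltn0Sn 0); rewrite expr0 mul1mx.
have [uE vO] := h i (ltnSn i).
rewrite rpredB ?mulv_oddK // rpredZ //.
exact: subvP (krylovS _ _ (leqnSn _)) _ uE.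
Qed.

Lemma gk_mem_parts (R : rcfType) n (A : 'M[R]_n) (b : 'cV[R]_n) m i :
  A^T = - A -> gk_runs A b m -> (i < m)%N ->
  gk_u (gk A b i) \in evenK A b i.+1 /\ gk_v (gk A b i) \in oddK A b i.+1.
Proof.
move=> skA h; elim/ltn_ind: i => i IH im.
have {}IH i' (ii : (i' < i)%N) := IH i' ii (ltn_trans ii im).
have [ru Au _ [be0 al0]] := gkP h im.
have uE : gk_u (gk A b i) \in evenK A b i.+1.
  by rewrite -[gk_u _](scalerK be0) -ru rpredZ //; exact: gk_ures_even.
split=> //; rewrite -[gk_v _](scalerK al0) rpredZ //.
rewrite -[X in X \in _](addrK (gk_beta (gk A b i) *: gk_vprev A b i)) -Au.
rewrite skA mulNmx rpredB ?rpredN ?mulv_evenK // rpredZ //.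
apply: mem_vprev => i' ii; have [_] := IH i' ii.
exact/subvP/krylovS/leqW.
Qed.

Lemma spanv_oddK (R : rcfType) n (A : 'M[R]_n) (b : 'cV[R]_n) j :
  A^T = - A -> gk_runs A b j -> (spanv A b j <= oddK A b j)%VS.
Proof.
move=> skA h; apply: spanv_subv => i ij.
have [_] := gk_mem_parts skA h ij; exact/subvP/krylovS.
Qed.

Lemma spanu_evenK (R : rcfType) n (A : 'M[R]_n) (b : 'cV[R]_n) j :
  A^T = - A -> gk_runs A b j -> (spanu A b j <= evenK A b j)%VS.
Proof.
move=> skA h; apply: spanu_subv => i ij.
have [+ _] := gk_mem_parts skA h ij; exact/subvP/krylovS.
Qed.

(** [A^2] maps the span of [u_0], ..., [u_(i-1)] into that of [u_0], ...,
    [u_i]. *)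
Lemma evenK_spanu (R : rcfType) n (A : 'M[R]_n) (b : 'cV[R]_n) j :
  A^T = - A -> gk_runs A b j -> (evenK A b j <= spanu A b j)%VS.
Proof.
move=> skA h; apply: krylov_subv => i ij.
suff: (A ^+ 2) ^+ i *m b \in spanu A b i.+1.
  apply/subvP/spanu_subv => i' ii; apply: mem_spanu.
  exact: leq_trans ii ij.
elim: i ij => [|i IH] ij.
  by rewrite expr0 mul1mx; apply: (gk_ures_span (gk_runsW ij h) (ltnSn 0)).
have ri := gk_runsW (ltnW ij) h.
rewrite exprS -mulmxE -mulmxA mulmx_sq.
apply: subvP (mulv_spanv ri (mulv_spanu skA ri (IH (ltnW ij)))).
rewrite subv_add -memvE (gk_ures_span (gk_runsW ij h)) // andbT.
by apply: spanu_subv => i' ii; apply: mem_spanu; apply: leqW.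
Qed.

(** Orthogonality to the odd part is a matter of parity; orthogonality to the
    even part follows from that of the left vectors. *)
Lemma gk_ures_orth_krylov (R : rcfType) n (A : 'M[R]_n) (b : 'cV[R]_n) j y :
  A^T = - A -> gk_runs A b j -> y \in krylov A b (2 * j) ->
  dotv y (gk_ures A b j) = 0.
Proof.
move=> skA h; rewrite krylov_even_odd => /memv_addP[e eE [o oO ->]].
have wE : gk_ures A b j \in evenK A b j.+1.
  by apply: gk_ures_even => i ij; apply: gk_mem_parts ij.
rewrite dotvC dotvDr (even_odd_orth skA wE oO) addr0.
apply/eqP; rewrite -mem_orthv.
apply: subvP (subvP (evenK_spanu skA h) _ eE).
apply: spanu_subv => i ij; rewrite mem_orthv dotvC gk_ures_orth //.
exact: gk_orth.
Qed.

(** * The CRAIG iterates *)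

Lemma gk_V_mul (R : rcfType) n j (s : 'I_j -> gk_data R n) (t : 'cV[R]_j) :
  gk_V s *m t = \sum_k t k 0 *: gk_v (s k).
Proof.
apply/matrixP => i l; rewrite ord1 !mxE summxE; apply: eq_bigr => k _.
by rewrite !mxE mulrC.
Qed.

Lemma gk_B_unit (R : rcfType) n j (s : 'I_j -> gk_data R n) :
  (forall i, gk_alpha (s i) != 0) -> gk_B s \in unitmx.
Proof.
move=> al0; rewrite unitmxE unitfE det_trig.
  by apply/prodf_neq0 => i _; rewrite mxE eqxx.
apply/is_trig_mxP => i k ik; rewrite mxE -(inj_eq val_inj) /= !ltn_eqF //.
exact: leq_trans ik (leqnSn k).
Qed.

(** Column [k] of [A V = U B + w e^T], where [e] is the last unit vector and
    [w] the vector to be normalized next. *)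
Lemma gk_mulv_col (R : rcfType) n (A : 'M[R]_n) (b : 'cV[R]_n) j
    (s := fun i : 'I_j.+1 => gk A b i) (k : 'I_j.+1) :
  gk_runs A b j.+1 ->
  A *m gk_v (s k) = \sum_i gk_B s i k *: gk_u (s i)
                    + (k == ord_max)%:R *: gk_ures A b j.+1.
Proof.
move=> h; rewrite (bigD1 k) // mxE eqxx -addrA /s.
have [kj|jk] := ltnP k j.
  (* The two nonzero entries of column [k] are in rows [k] and [k.+1]. *)
  have k1 : (k.+1 < j.+1)%N by [].
  rewrite (gk_mulvS h k1) (bigD1 (Ordinal k1)) /=; last first.
    by rewrite -(inj_eq val_inj) /= gtn_eqF.
  rewrite mxE -(inj_eq val_inj) /= gtn_eqF // eqxx big1 ?addr0.
    by rewrite -(inj_eq val_inj) /= ltn_eqF // scale0r addr0.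
  move=> i /andP[ik ik1]; rewrite mxE (negbTE ik).
  by rewrite -[(i == k.+1 :> nat)]/(i == Ordinal k1) (negbTE ik1) scale0r.
have -> : k = ord_max.
  by apply/val_inj/eqP; rewrite eqn_leq jk -ltnS ltn_ord.
rewrite gk_mulv eqxx scale1r big1 ?add0r // => i ik.
by rewrite mxE (negbTE ik) ltn_eqF ?scale0r.
Qed.

(** The CRAIG iterate exists and is unique because the bidiagonal matrix is
    invertible; its residual comes from [A V t = U B t + t_last w]. *)
Lemma craigP (R : rcfType) n (A : 'M[R]_n) (b : 'cV[R]_n) j :
  gk_runs A b j -> (0 < j)%N ->
  exists x, [/\ forall y, craig_iterate A b j y <-> y = x,
                x \in spanv A b j
              & exists c, A *m x = b + c *: gk_ures A b j].
Proof.
case: j => // j h _; pose s (i : 'I_j.+1) := gk A b i.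
have uB : gk_B s \in unitmx.
  by apply: gk_B_unit => i; have [_ _ _ []] := gkP h (ltn_ord i).
pose t := invmx (gk_B s) *m gk_rhs s.
have Bt : gk_B s *m t = gk_rhs s by rewrite mulmxA mulmxV // mul1mx.
exists (gk_V s *m t); split.
- move=> y; split=> [[s' [t' [hs' Bt' ->]]]|->]; last first.
    by exists s, t; split=> // i; apply: h.
  have es i : s' i = s i by have := hs' i; rewrite (h i) // => -[<-].
  have eB : gk_B s' = gk_B s by apply/matrixP => i k; rewrite !mxE !es.
  have er : gk_rhs s' = gk_rhs s by apply/matrixP => i k; rewrite !mxE !es.
  have -> : gk_V s' = gk_V s by apply/matrixP => i k; rewrite !mxE !es.
  by congr (_ *m _); rewrite /t -er -Bt' eB mulmxA mulVmx // mul1mx.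
- by rewrite gk_V_mul rpred_sum // => k _; rewrite rpredZ ?mem_spanv.
exists (t ord_max 0); rewrite gk_V_mul mulmx_sumr.
under eq_bigr => k _ do rewrite -scalemxAr gk_mulv_col // scalerDr scalerA.
rewrite big_split /=; congr (_ + _); last first.
  rewrite (bigD1 ord_max) //= eqxx mulr1 big1 ?addr0 // => k /negbTE ->.
  by rewrite mulr0 scale0r.
under eq_bigr => k _ do rewrite scaler_sumr.
rewrite exchange_big /=.
transitivity (\sum_i gk_rhs s i 0 *: gk_u (s i)).
  apply: eq_bigr => i _; rewrite -Bt mxE scaler_suml.
  by apply: eq_bigr => k _; rewrite scalerA mulrC.
rewrite (bigD1 ord0) //= mxE eqxx big1 ?addr0.
  by have [<-] := gkP h (ltn0Sn j).
move=> i i0; rewrite mxE ifN ?scale0r //.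
Qed.

Lemma craig_galerkin (R : rcfType) n (A : 'M[R]_n) (b : 'cV[R]_n) j x c :
  A^T = - A -> gk_runs A b j -> x \in spanv A b j ->
  A *m x = b + c *: gk_ures A b j -> galerkin_iterate A b (2 * j) x.
Proof.
move=> skA h xV Ax; split; first exact/oddK_sub/(subvP (spanv_oddK skA h)).
move=> y yK; rewrite Ax opprD addNKr dotvNr dotvZr.
by rewrite gk_ures_orth_krylov // mulr0 oppr0.
Qed.

(** When the [j] left vectors exhaust the even parts, the next residual
    vanishes, being both in their span and orthogonal to it. *)
Lemma gk_ures_last (R : rcfType) n (A : 'M[R]_n) (b : 'cV[R]_n) j k :
  A^T = - A -> gk_runs A b j -> (j < k)%N -> \dim (evenK A b k) = j ->
  gk_ures A b j = 0.
Proof.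
move=> skA h jk dE.
have wE : gk_ures A b j \in evenK A b k.
  apply: subvP (krylovS _ _ jk) _ _.
  by apply: gk_ures_even => i ij; apply: gk_mem_parts ij.
have EU : evenK A b k = spanu A b j.
  apply/esym/eqP; rewrite eqEdim dE; apply/andP; split.
    exact: subv_trans (spanu_evenK skA h) (krylovS _ _ (ltnW jk)).
  have /eqP -> := orthonormal_free (gk_orthonormal h).
  by rewrite size_mkseq.
apply/eqP; rewrite -dotv_eq0; apply/eqP/gk_ures_orth_krylov => //.
by apply/evenK_sub/(subvP (spanu_evenK skA h)); rewrite -EU.
Qed.

Theorem proposition2 (R : realType) (n : nat) (A : 'M[R]_n) (b : 'cV[R]_n)
    (ell : nat)
    (hA0 : A != 0) (hAsing : A \notin unitmx) (hAskew : A^T = - A)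
    (hbrange : exists y : 'cV[R]_n, b = A *m y) (hb0 : b != 0)
    (hell : max_dim_krylov A b ell) :
  [/\ ~~ odd ell,
      (forall j : nat, (1 <= j)%N -> (j <= ell %/ 2)%N ->
        exists x : 'cV[R]_n,
          (forall y : 'cV[R]_n, galerkin_iterate A b (2 * j) y <-> y = x) /\
          (forall y : 'cV[R]_n, craig_iterate A b j y <-> y = x))
    & (forall y : 'cV[R]_n, galerkin_iterate A b ell y <-> y = mpinv A *m b)].
Proof.
have bA : b \in limg (mulv A).
  by have [y ->] := hbrange; rewrite -mulvE memv_img ?memvf.
have [[k0 dk0] maxell] := hell.
(* [k] is large enough for [K_2k] to have the maximal dimension, and for [E_k]
   to contain the vector left over after [ell / 2] steps. *)
pose k := maxn k0 ell.+1.
have dk : \dim (krylov A b (2 * k)) = ell.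
  apply/eqP; rewrite eqn_leq maxell -{1}dk0; apply/dimvS/krylovS.
  by rewrite mul2n -addnn; apply: leq_trans (leq_maxl _ _) (leq_addr _ _).
pose m := \dim (evenK A b k).
have ellE : ell = (2 * m)%N by rewrite -dk dim_krylov_even.
have runs : gk_runs A b m.
  by rewrite /m -(dim_oddK k hAskew bA); apply: gk_runs_dim.
have lt_mk : (m < k)%N.
  by rewrite leq_max orbC ltnS ellE mul2n -addnn leq_addr.
have lt0m : (0 < m)%N.
  rewrite lt0n dimv_eq0; apply: contra hb0 => /eqP E0.
  have := mem_krylov (A ^+ 2) b (leq_ltn_trans (leq0n m) lt_mk).
  by rewrite -/(evenK A b k) E0 memv0 expr0 mul1mx.
have galE j x c : (j <= m)%N -> x \in spanv A b j ->
    A *m x = b + c *: gk_ures A b j ->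
    forall y, galerkin_iterate A b (2 * j) y <-> y = x.
  move=> jm xV Ax y; have gx := craig_galerkin hAskew (gk_runsW jm runs) xV Ax.
  by split=> [gy|->//]; apply: galerkin_unique gy gx.
split.
- by rewrite ellE oddM.
- move=> j j0; rewrite ellE mulKn // => jm.
  have [x [cx xV [c Ax]]] := craigP (gk_runsW jm runs) j0.
  by exists x; split=> //; apply: galE Ax.
have [x [_ xV [c Ax]]] := craigP runs lt0m.
have Axb : A *m x = b.
  by rewrite Ax (gk_ures_last hAskew runs lt_mk) // scaler0 addr0.
have <- : x = mpinv A *m b.
  rewrite -Axb mpinv_skew //; apply: subvP xV.
  apply: subv_trans (spanv_oddK hAskew runs) _.
  by rewrite oddK_img limgS // subvf.
by rewrite ellE; apply: galE Ax.
Qed.
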